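(* Let $f$ be a homogeneous polynomial of degree $p$ in $\mathbb{R}[t_1,\ldots,t_s]$ and let $\mathcal{P}$ be a lattice polytope in $\mathbb{R}^s$. Then there are $c_1,c_2\in\mathbb{R}$, $c_1\le c_2$, such that $$c_1n^pE_{\mathcal{P}}(n)\le E_{\mathcal{P}}^{s,f}(n)\le c_2n^pE_{\mathcal{P}}(n)\quad\text{for all integers }n\ge0.$$
   Context: $E_{\mathcal{P}}(n)=|n\mathcal{P}\cap\mathbb{Z}^s|$ is the Ehrhart function of $\mathcal{P}$, and $E_{\mathcal{P}}^{s,f}(n)=\sum_{a\in n\mathcal{P}\cap\mathbb{Z}^s}f(a)$ is the $s$-weighted Ehrhart function (the superscript $s$ names the weighting). The convention $0^0=1$ is used. *)

(* Defs.v *)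
From HB Require Import structures.
From mathcomp Require Import all_boot all_order all_algebra.
From mathcomp Require Import finmap mpoly.
From mathcomp Require Import boolp classical_sets cardinality fsbigop reals.

Set Implicit Arguments.
Unset Strict Implicit.
Unset Printing Implicit Defensive.

Import Order.TTheory GRing.Theory Num.Theory.

Local Open Scope classical_set_scope.
Local Open Scope ring_scope.

Definition conv_hull (R : realType) (s : nat) (A : set 'rV[R]_s) :
    set 'rV[R]_s :=
  [set x | exists (k : nat) (v : 'I_k -> 'rV[R]_s) (l : 'I_k -> R),
     [/\ forall i, A (v i),
         forall i, 0 <= l i,
         \sum_(i < k) l i = 1
       & x = \sum_(i < k) l i *: v i]].

Definition lattice_embed (R : realType) (s : nat) (a : 'rV[int]_s) :
    'rV[R]_s :=
  map_mx intr a.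
Arguments lattice_embed R {s} a.

(* The empty set is allowed (as the hull of the empty set). *)
Definition lattice_polytope (R : realType) (s : nat) (P : set 'rV[R]_s) :
    Prop :=
  exists2 V : set 'rV[int]_s,
    finite_set V & P = conv_hull (lattice_embed R @` V).

Definition dilate (R : realType) (s : nat) (n : nat) (P : set 'rV[R]_s) :
    set 'rV[R]_s :=
  [set n%:R *: x | x in P].

Definition lattice_points (R : realType) (s : nat) (A : set 'rV[R]_s) :
    set 'rV[int]_s :=
  [set a | A (lattice_embed R a)].

(* [fset_set] is the empty finite set on infinite sets. This junk value does
   not arise for a lattice polytope, whose dilates are bounded and hence
   contain finitely many lattice points. *)
Definition ehrhart (R : realType) (s : nat) (P : set 'rV[R]_s) (n : nat) :
    nat :=
  #|` fset_set (lattice_points (dilate n P))|.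

Definition weighted_ehrhart (R : realType) (s : nat) (f : {mpoly R[s]})
    (P : set 'rV[R]_s) (n : nat) : R :=
  \sum_(a <- fset_set (lattice_points (dilate n P)))
     f.@[fun i => lattice_embed R a 0 i].

(* Main.v *)
Require Import Defs.
From HB Require Import structures.
From mathcomp Require Import all_boot all_order all_algebra.
From mathcomp Require Import finmap mpoly.
From mathcomp Require Import boolp classical_sets cardinality fsbigop reals.

(** A polytope is bounded, so some [B] dominates the absolute values of all
    coordinates of all its points, and [n * B] does so on its [n]-th dilate.
    Every monomial of [f] has total degree [p], so at a point of the [n]-th
    dilate its absolute value is at most [(n * B) ^+ p = B ^+ p * n ^+ p]
    (lemma [norm_meval_homog_le]).  Hence the values of [f] that are summed in
    the weighted Ehrhart function all lie between [- M * n ^+ p] and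
    [M * n ^+ p], where [M] is [B ^+ p] times the sum of the absolute values of
    the coefficients of [f]; summing over the lattice points of the dilate
    gives the two inequalities with [c1 = - M] and [c2 = M].  Estimating
    monomials on the dilate itself, rather than pulling the points back to the
    polytope, treats [n = 0] together with all other [n]. *)

Set Implicit Arguments.
Unset Strict Implicit.
Unset Printing Implicit Defensive.

Import Order.TTheory GRing.Theory Num.Theory.
Local Open Scope ring_scope.

(** Homogeneity gives all monomials the same bound [B ^+ p], so that it can be
    factored out of the triangle inequality. *)
Lemma norm_meval_homog_le (R : realDomainType) (s p : nat) (f : {mpoly R[s]})
    (B : R) (v : 'I_s -> R) :
  f \is p.-homog -> (forall i, `|v i| <= B) ->
  `|f.@[v]| <= (\sum_(m <- msupp f) `|f@_m|) * B ^+ p.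
Proof.
move=> /dhomogP hf hv; rewrite mevalE mulr_suml.
apply: le_trans (ler_norm_sum _ _ _) _.
rewrite big_seq [leRHS]big_seq; apply: ler_sum => m mf.
rewrite normrM ler_wpM2l // normr_prod -(hf m mf) /= mdegE expr_sum.
by apply: ler_prod => i _; rewrite normr_ge0 normrX lerXn2r ?nnegrE ?(le_trans _ (hv i)).
Qed.

Lemma conv_hull_coord_le (R : realType) (s : nat) (A : set 'rV[R]_s) (B : R) :
  (forall v, A v -> forall j, `|v 0 j| <= B) ->
  forall x, conv_hull A x -> forall j, `|x 0 j| <= B.
Proof.
move=> hA x [k [v [l [Av l0 l1 ->]]]] j.
rewrite summxE -[leRHS]mul1r -l1 mulr_suml.
apply: le_trans (ler_norm_sum _ _ _) _; apply: ler_sum => i _.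
by rewrite mxE normrM ger0_norm // ler_wpM2l // hA.
Qed.

Lemma lattice_polytope_bounded (R : realType) (s : nat) (P : set 'rV[R]_s) :
  lattice_polytope P ->
  exists2 B : R, 0 <= B & forall x, P x -> forall j, `|x 0 j| <= B.
Proof.
move=> [V finV ->].
(* The sum over all vertices and coordinates serves as a maximum that needs
   no nonemptiness. *)
exists (\sum_(v <- fset_set V) \sum_(j < s) `|lattice_embed R v 0 j|).
  by apply: sumr_ge0 => v _; apply: sumr_ge0.
apply: conv_hull_coord_le => _ [v Vv <-] j.
have vV : v \in fset_set V by rewrite in_fset_set // inE.
rewrite (big_fsetD1 v) //= (bigD1 j) //= -addrA lerDl.
by apply: addr_ge0; apply: sumr_ge0 => // w _; apply: sumr_ge0.
Qed.

Lemma dilate_coord_le (R : realType) (s n : nat) (P : set 'rV[R]_s) (B : R) :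
  (forall x, P x -> forall j, `|x 0 j| <= B) ->
  forall x, dilate n P x -> forall j, `|x 0 j| <= n%:R * B.
Proof.
move=> hP _ [x Px <-] j.
by rewrite mxE normrM normr_nat ler_wpM2l // hP.
Qed.

(** Infinite sets are covered too, since [fset_set] sends them to the empty
    finite set; this dispenses with proving that the sets of lattice points
    below are finite. *)
Lemma mem_fset_set_sub (T : choiceType) (A : set T) (a : T) :
  a \in fset_set A -> A a.
Proof.
have [finA|infA] := pselect (finite_set A); first by rewrite in_fset_set // inE.
by rewrite /fset_set; case: pselect.
Qed.

Theorem proposition5p3 (R : realType) (s p : nat) (f : {mpoly R[s]})
    (hf : f \is p.-homog) (P : set 'rV[R]_s) (hP : lattice_polytope P) :
  exists c1 c2 : R, c1 <= c2 /\
    forall n : nat,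
      c1 * n%:R ^+ p * (ehrhart P n)%:R <= weighted_ehrhart f P n /\
      weighted_ehrhart f P n <= c2 * n%:R ^+ p * (ehrhart P n)%:R.
Proof.
have [B B0 hB] := lattice_polytope_bounded hP.
pose M := (\sum_(m <- msupp f) `|f@_m|) * B ^+ p.
have M0 : 0 <= M by rewrite mulr_ge0 ?exprn_ge0 ?sumr_ge0.
exists (- M), M; split; first by rewrite (le_trans _ M0) // oppr_le0.
move=> n; apply/andP; rewrite !mulNr -ler_norml.
rewrite /ehrhart /weighted_ehrhart mulr_natr -sum1_size -sumrMnr.
apply: le_trans (ler_norm_sum _ _ _) _.
rewrite big_seq [leRHS]big_seq; apply: ler_sum => a /mem_fset_set_sub aP.
rewrite mulr1n /M -mulrA -exprMn [B * _]mulrC.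
exact: norm_meval_homog_le hf (dilate_coord_le hB aP).
Qed.
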